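(* Let $E$ be a finite-dimensional vector space over a field and let $\mathrm{cl}:\mathcal{L}(E)\to\mathcal{L}(E)$ satisfy (Cl1)–(Cl4). Define $r_{\mathrm{cl}}(A):=\min\{\dim I: I\subseteq A,\ \mathrm{cl}(I)=\mathrm{cl}(A)\}$ for $A\in\mathcal{L}(E)$. Then $r_{\mathrm{cl}}$ satisfies (R1) $0\le r_{\mathrm{cl}}(A)\le\dim A$ for all $A$; (R2) $r_{\mathrm{cl}}(A)\le r_{\mathrm{cl}}(B)$ whenever $A\subseteq B$; (R3) $r_{\mathrm{cl}}(A+B)+r_{\mathrm{cl}}(A\cap B)\le r_{\mathrm{cl}}(A)+r_{\mathrm{cl}}(B)$ for all $A,B$.
   Context: $\mathcal{L}(E)$ is the lattice of subspaces of $E$. Closure axioms: (Cl1) $A\subseteq\mathrm{cl}(A)$; (Cl2) $A\subseteq B\Rightarrow\mathrm{cl}(A)\subseteq\mathrm{cl}(B)$; (Cl3) $\mathrm{cl}(\mathrm{cl}(A))=\mathrm{cl}(A)$; (Cl4) for all subspaces $A$ and $1$-dimensional $x,y$, if $y\subseteq\mathrm{cl}(A+x)$ and $y\not\subseteq\mathrm{cl}(A)$ then $x\subseteq\mathrm{cl}(A+y)$. *)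

(* Defs.v *)
From mathcomp Require Import all_boot all_algebra.
From mathcomp Require Import boolp.
Set Implicit Arguments.
Unset Strict Implicit.
Unset Printing Implicit Defensive.
Import GRing.Theory.

Section QClosure.
Variables (K : fieldType) (E : vectType K).
Implicit Types (cl : {vspace E} -> {vspace E}) (r : {vspace E} -> nat).
Implicit Types A B I x y : {vspace E}.

Definition Cl1 cl := forall A, (A <= cl A)%VS.

Definition Cl2 cl := forall A B, (A <= B)%VS -> (cl A <= cl B)%VS.

Definition Cl3 cl := forall A, cl (cl A) = cl A.

Definition Cl4 cl := forall A x y, \dim x = 1%N -> \dim y = 1%N ->
  (y <= cl (A + x))%VS -> ~~ (y <= cl A)%VS -> (x <= cl (A + y))%VS.

Definition spanning_dim cl A : pred nat := fun n =>
  `[< exists I, [/\ (I <= A)%VS, cl I = cl A & \dim I = n] >].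

Lemma spanning_dim_ex cl A : exists n, spanning_dim cl A n.
Proof. by exists (\dim A); apply/asboolP; exists A; split. Qed.

(* The subspaces of A may be infinite in number, so the minimum is taken over
   the set of dimensions, which is nonempty because I = A qualifies. *)
Definition r_cl cl A : nat := ex_minn (spanning_dim_ex cl A).

Definition R1 r := forall A, (0 <= r A <= \dim A)%N.

Definition R2 r := forall A B, (A <= B)%VS -> (r A <= r B)%N.

Definition R3 r :=
  forall A B, (r (A + B)%VS + r (A :&: B)%VS <= r A + r B)%N.

End QClosure.

(* Main.v *)
Require Import Defs.
From mathcomp Require Import all_boot all_algebra.
From mathcomp Require Import boolp.

(**
  Adding vectors one at a time to a subspace A, count those lying outside the
  closure of what has been accumulated so far.  By the exchange axiom (Cl4) this
  count is unchanged when two consecutive vectors are swapped, so it depends only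
  on the closure of the resulting subspace.  Started at A = 0 with a basis of B,
  it therefore defines a rank of B; the counted vectors span a subspace witnessing
  that this rank is r_cl B.  By (Cl2) the count decreases when the starting
  subspace A grows, and this is submodularity: a basis of A adds at most as much
  rank to B as it does to the intersection of A and B.
*)

Section ClosureRank.
Set Implicit Arguments.
Unset Strict Implicit.
Variables (K : fieldType) (E : vectType K).
Implicit Types (A B C I : {vspace E}) (x y : E) (xs ys : seq E).
Local Open Scope vspace_scope.

Variable cl : {vspace E} -> {vspace E}.
Hypotheses (h1 : Cl1 cl) (h2 : Cl2 cl) (h3 : Cl3 cl) (h4 : Cl4 cl).

Lemma sub_cl_trans A B : A <= cl B -> cl A <= cl B.
Proof. by move=> sAB; rewrite -(h3 B); apply: h2. Qed.

Lemma cl_sandwich A B : A <= B -> B <= cl A -> cl B = cl A.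
Proof.
by move=> sAB sBA; apply/eqP; rewrite eqEsubv sub_cl_trans // h2.
Qed.

Lemma cl_addl A x : x \in cl A -> cl (A + <[x]>) = cl A.
Proof. by move=> xA; apply: cl_sandwich; rewrite ?addvSl // subv_add h1. Qed.

Lemma mem_clS A B x : A <= B -> x \in cl A -> x \in cl B.
Proof. by move=> /h2 /subvP; apply. Qed.

Lemma cl_exchange A x y :
  y \in cl (A + <[x]>) -> y \notin cl A -> x \in cl (A + <[y]>).
Proof.
(* (Cl4) only concerns lines, so zero vectors are treated apart. *)
have [-> _ _|x0] := eqVneq x 0%R; first exact: mem0v.
have [->|y0] := eqVneq y 0%R; first by rewrite !mem0v.
rewrite !memvE; apply: h4; first by rewrite dim_vline x0.
by rewrite dim_vline y0.
Qed.

Fixpoint cl_gain A xs : nat :=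
  if xs is x :: xs' then (x \notin cl A) + cl_gain (A + <[x]>) xs' else 0%N.

Lemma cl_gain_swap A x y xs :
  cl_gain A [:: x, y & xs] = cl_gain A [:: y, x & xs].
Proof.
rewrite /= -!addvA (addvC <[y]>) !addnA; congr (_ + _)%N.
have [xA|xA] := boolP (x \in cl A).
  by rewrite (cl_addl xA) (mem_clS (addvSl A <[y]>) xA) addn0.
have [yA|yA] := boolP (y \in cl A).
  by rewrite (cl_addl yA) (mem_clS (addvSl A <[x]>) yA) xA.
congr (_ + ~~ _)%N.
by apply/idP/idP => mem; apply: cl_exchange.
Qed.

Lemma cl_gain_middle A x xs ys :
  cl_gain A (xs ++ x :: ys) = cl_gain A (x :: xs ++ ys).
Proof.
elim: xs A => // z xs IH A.
by rewrite [RHS]cl_gain_swap cat_cons [LHS]/= IH.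
Qed.

Lemma cl_gain_catC A xs ys : cl_gain A (xs ++ ys) = cl_gain A (ys ++ xs).
Proof.
by elim: ys A => [|y ys IH] A; rewrite ?cats0 // cl_gain_middle /= IH.
Qed.

Lemma cl_gain_cat A xs ys :
  cl_gain A (xs ++ ys) = (cl_gain A xs + cl_gain (A + <<xs>>) ys)%N.
Proof.
elim: xs A => [|x xs IH] A; first by rewrite span_nil addv0.
by rewrite /= IH span_cons addvA addnA.
Qed.

Lemma cl_gainS A B xs : A <= B -> (cl_gain B xs <= cl_gain A xs)%N.
Proof.
elim: xs A B => //= x xs IH A B sAB.
apply: leq_add; last by apply: IH; apply: addvS.
case xA: (x \in cl A); last exact: leq_b1.
by rewrite (mem_clS sAB xA).
Qed.

Lemma cl_gain_size A xs : (cl_gain A xs <= size xs)%N.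
Proof.
elim: xs A => //= x xs IH A; rewrite -add1n.
by apply: leq_add; first exact: leq_b1.
Qed.

Lemma cl_gain_eq0 A xs : <<xs>> <= cl A -> cl_gain A xs = 0%N.
Proof.
elim: xs A => //= x xs IH A; rewrite span_cons subv_add -memvE => /andP[xA sA].
by rewrite xA IH // cl_addl.
Qed.

(** After [ys] the vectors [xs] gain nothing, so [ys ++ xs] gains as much as [ys]; in the order
    [xs ++ ys] the same total includes the gain of [xs]. *)
Lemma cl_gain_spanS A xs ys :
  <<xs>> <= cl (A + <<ys>>) -> (cl_gain A xs <= cl_gain A ys)%N.
Proof.
move=> sxy; rewrite -[leqRHS]addn0 -(cl_gain_eq0 sxy) -cl_gain_cat.
by rewrite cl_gain_catC cl_gain_cat leq_addr.
Qed.

Lemma cl_gain_witness A xs : exists ys,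
  [/\ <<ys>> <= <<xs>>, cl (A + <<ys>>) = cl (A + <<xs>>)
    & size ys = cl_gain A xs].
Proof.
elim: xs A => [|x xs IH] A /=; first by exists [::].
have [ys [sub eqcl szys]] := IH (A + <[x]>).
have [xA|xA] := boolP (x \in cl A); last first.
  by exists (x :: ys); rewrite /= !span_cons !addvA szys addvS.
(* An uncounted [x] is dropped: it already lies in [cl A]. *)
exists ys; rewrite span_cons; split=> //.
  exact: subv_trans sub (addvSr _ _).
rewrite addvA -eqcl; apply/esym/cl_sandwich; first by rewrite addvS ?addvSl.
rewrite !subv_add -memvE (mem_clS (addvSl _ _) xA).
by rewrite !(subv_trans _ (h1 _)) ?addvSl ?addvSr.
Qed.

Definition cl_rank A := cl_gain 0 (vbasis A).

Lemma span_vbasis A : <<vbasis A>> = A.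
Proof. exact: span_basis (vbasisP A). Qed.

Lemma cl_rank_leq_dim A : (cl_rank A <= \dim A)%N.
Proof. by rewrite (leq_trans (cl_gain_size _ _)) // size_tuple. Qed.

(** The bound [cl B] lets this also compare subspaces with equal closures. *)
Lemma cl_rankS A B : A <= cl B -> (cl_rank A <= cl_rank B)%N.
Proof. by move=> sAB; apply: cl_gain_spanS; rewrite !span_vbasis add0v. Qed.

(** The two bases joined may be dependent, but they span [A + B], and the gain depends only on the
    span. *)
Lemma cl_rank_addv A B : cl_rank (A + B) = (cl_rank A + cl_gain A (vbasis B))%N.
Proof.
have -> : cl_gain A (vbasis B) = cl_gain (0 + <<vbasis A>>) (vbasis B).
  by rewrite span_vbasis add0v.
rewrite -cl_gain_cat; apply/eqP; rewrite eqn_leq.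
by rewrite !cl_gain_spanS // span_cat !span_vbasis add0v h1.
Qed.

Lemma cl_rank_submod A B :
  (cl_rank (A + B) + cl_rank (A :&: B) <= cl_rank A + cl_rank B)%N.
Proof.
rewrite cl_rank_addv -addnA leq_add2l addnC.
(* Writing [B] as [A :&: B + B] leaves the gains of one basis of [B] over [A] and over [A :&: B] to
   compare. *)
rewrite -[in leqRHS](addv_idPr (capvSr A B)).
by rewrite cl_rank_addv leq_add2l cl_gainS // capvSl.
Qed.

Lemma r_clE A : r_cl cl A = cl_rank A.
Proof.
rewrite /r_cl; case: ex_minnP => n /asboolP[I [sIA clI <-]] minI.
apply/eqP; rewrite eqn_leq; apply/andP; split; last first.
  (* Any competitor [I] has the closure of [A], hence at least its rank. *)
  by rewrite (leq_trans _ (cl_rank_leq_dim I)) // cl_rankS // clI h1.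
have [ys [sub eqcl szys]] := cl_gain_witness 0 (vbasis A).
rewrite !add0v span_vbasis in sub eqcl.
(* The span of the counted vectors is a competitor of dimension at most [cl_rank A]. *)
rewrite /cl_rank -szys (leq_trans _ (dim_span ys)) //.
by apply: minI; apply/asboolP; exists <<ys>>.
Qed.

End ClosureRank.

Theorem theorem51 (K : fieldType) (E : vectType K)
    (cl : {vspace E} -> {vspace E})
    (h1 : Cl1 cl) (h2 : Cl2 cl) (h3 : Cl3 cl) (h4 : Cl4 cl) :
  R1 (r_cl cl) /\ R2 (r_cl cl) /\ R3 (r_cl cl).
Proof.
split; [|split] => [A|A B sAB|A B]; rewrite !r_clE //.
- exact: cl_rank_leq_dim.
- by apply: cl_rankS => //; apply: subv_trans sAB (h1 B).
- exact: cl_rank_submod.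
Qed.
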